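(* Let $\{h_k\}_{k\ge1}$ and $\{g_k\}_{k\ge1}$ be sequences of pairwise disjoint measurable subsets of $(0,1)$ with $\lambda(h_k)=2^{-k-2^k}$ and $\lambda(g_k)=4^{-k-4^k}$, and put $$x=\sum_{k=1}^\infty 2^{2^k}\chi_{h_k},\qquad y=\sum_{k=1}^\infty 4^{4^k}\chi_{g_k}.$$ Then the distributions of the functions $x$ and $y$ are not equivalent, i.e. there is no constant $0<C<\infty$ such that $C^{-1}n_x(\tau)\le n_y(\tau)\le C\,n_x(\tau)$ for all $\tau>0$.
   Context: $\lambda$ is Lebesgue measure, $\chi_c$ is the indicator function of a set $c$, and $n_f(\tau)=\lambda\{u\in(0,1):|f(u)|>\tau\}$, $\tau>0$, is the distribution function of $f$. *)

(* Defs.v *)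
From HB Require Import structures.
From mathcomp Require Import all_boot all_order all_algebra.
From mathcomp Require Import all_classical all_reals all_analysis.

Set Implicit Arguments.
Unset Strict Implicit.
Unset Printing Implicit Defensive.

Import Order.TTheory GRing.Theory Num.Theory.
Import numFieldNormedType.Exports.

Local Open Scope classical_set_scope.
Local Open Scope ring_scope.

(* Lebesgue (not merely Borel) measurability: this is the sigma-algebra on
   which [completed_lebesgue_measure] is a measure. *)
Definition lebesgue_measurable (R : realType) : set (set R) :=
  ((@wlength R idfun)^*)%mu.-cara.-measurable.

(* A function on (0,1) is represented by any extension of it to R; only its
   values on (0,1) matter here. *)
Definition distribution_function (R : realType) (f : R -> R) (tau : R) : \bar R :=
  completed_lebesgue_measure [set u : R | 0 < u < 1 /\ tau < `|f u|].

Definition equivalent_distributions (R : realType) (f g : R -> R) : Prop :=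
  exists C : R, 0 < C /\
    forall tau : R, 0 < tau ->
      (C^-1%:E * distribution_function f tau <= distribution_function g tau)%E /\
      (distribution_function g tau <= C%:E * distribution_function f tau)%E.

(* Main.v *)
(* Take tau = 4^(4^m).  Then {y > tau} is the union of the g_j with j > m, of
   measure at most 4^(-4^(m+1)), whereas {x > tau} contains h_(2(m+1)), of measure
   2^(-2(m+1)-4^(m+1)).  Hence n_x(tau) / n_y(tau) >= 2^(4^(m+1)-2(m+1)), which is
   unbounded in m. *)
Require Import Defs.
From HB Require Import structures.
From mathcomp Require Import all_boot all_order all_algebra.
From mathcomp Require Import all_classical all_reals all_analysis.
From mathcomp Require Import zify.
Import Order.TTheory GRing.Theory Num.Theory.
Import numFieldNormedType.Exports.

Local Open Scope classical_set_scope.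
Local Open Scope ring_scope.

(** Disjointness leaves [k] as the only index with a nonzero term, so the partial sums are constant
    once [k] is in range, that is from [n = k.+1] on. *)
Lemma limn_sum_indic (R : realType) (c : nat -> set R) (a : nat -> R) (u : R)
    (k : nat) :
  trivIset [set k : nat | (1 <= k)%N] c -> (1 <= k)%N -> c k u ->
  limn (fun n : nat => \sum_(1 <= j < n) a j * \1_(c j) u : R) = a k.
Proof.
move=> c_disj k1 cku; apply: lim_near_cst; first exact: norm_hausdorff.
exists k.+1 => // n /= ltkn.
rewrite (bigD1_seq k) ?iota_uniq ?mem_index_iota ?k1 //=.
rewrite indicE mem_set// mulr1 big_seq_cond big1 ?addr0// => j.
rewrite mem_index_iota => /andP[/andP[j1 _] jk].
rewrite indicE memNset ?mulr0// => cju.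
by move/eqP: jk; apply; apply: c_disj => //; exists u.
Qed.

Lemma limn_sum_indic0 (R : realType) (c : nat -> set R) (a : nat -> R) (u : R) :
  (forall k : nat, (1 <= k)%N -> ~ c k u) ->
  limn (fun n : nat => \sum_(1 <= j < n) a j * \1_(c j) u : R) = 0.
Proof.
move=> cu; apply: lim_near_cst; first exact: norm_hausdorff.
apply: nearW => n; rewrite big_nat_cond big1// => j /andP[/andP[j1 _] _].
by rewrite indicE memNset ?mulr0//; exact: cu.
Qed.

(* [completed_lebesgue_measure] is by definition the restriction of an outer
   measure, so neither of the next two lemmas needs measurability. *)
Lemma le_completed_lebesgue_measure (R : realType) (A B : set R) :
  A `<=` B ->
  (completed_lebesgue_measure A <= completed_lebesgue_measure B)%E.
Proof. exact: (le_outer_measure (@wlength R idfun)^*%mu). Qed.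

Lemma completed_lebesgue_measure_bigcup_le (R : realType) (A : nat -> set R)
    (e : R) :
  0 <= e ->
  (forall n, (completed_lebesgue_measure (A n) <= (e / (2 ^ n.+1)%:R)%:E)%E) ->
  (completed_lebesgue_measure (\bigcup_n A n) <= e%:E)%E.
Proof.
move=> e0 Ae.
apply: (le_trans (outer_measure_sigma_subadditive (@wlength R idfun)^*%mu A)).
apply: (le_trans _ (epsilon_trick0 xpredT e0)).
by apply: lee_nneseries => n *; [exact: outer_measure_ge0|exact: Ae].
Qed.

(** On [h k] the function [x] is constantly [2 ^ (2 ^ k)], which exceeds [tau]. *)
Lemma distribution_function_ge (R : realType) (h : nat -> set R) (x : R -> R)
    (h_sub : forall k : nat, (1 <= k)%N -> h k `<=` [set u : R | 0 < u < 1])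
    (h_disj : trivIset [set k : nat | (1 <= k)%N] h)
    (x_def : forall u : R, 0 < u < 1 ->
      x u = limn (fun n : nat => \sum_(1 <= k < n) 2 ^+ (2 ^ k)%N * \1_(h k) u : R))
    (k : nat) (tau : R) :
  (1 <= k)%N -> tau < 2 ^+ (2 ^ k)%N ->
  (completed_lebesgue_measure (h k) <= distribution_function x tau)%E.
Proof.
move=> k1 tauk; apply: le_completed_lebesgue_measure => u hku.
have u01 : 0 < u < 1 by exact: h_sub hku.
split => //; rewrite x_def// (limn_sum_indic _ _ _ _ _ h_disj k1 hku).
by rewrite ger0_norm ?exprn_ge0.
Qed.

(** The superlevel set lies in the union of the [g j] with [j > m], whose measures are dominated by
    a geometric series with ratio 1/2 and sum [4 ^- (4 ^ m.+1)]. *)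
Lemma distribution_function_le (R : realType) (g : nat -> set R) (y : R -> R)
    (g_disj : trivIset [set k : nat | (1 <= k)%N] g)
    (g_size : forall k : nat, (1 <= k)%N ->
      completed_lebesgue_measure (g k) = (4 ^- (k + 4 ^ k)%N)%:E)
    (y_def : forall u : R, 0 < u < 1 ->
      y u = limn (fun n : nat => \sum_(1 <= k < n) 4 ^+ (4 ^ k)%N * \1_(g k) u : R))
    (m : nat) :
  (distribution_function y (4 ^+ (4 ^ m)%N) <= (4 ^- (4 ^ m.+1)%N)%:E)%E.
Proof.
have tail : [set u : R | 0 < u < 1 /\ 4 ^+ (4 ^ m)%N < `|y u|] `<=`
    \bigcup_n g (m + n.+1)%N.
  move=> u [u01]; rewrite y_def//.
  have [[k [k1 gku]]|/forallNP nog] := pselect (exists k, (1 <= k)%N /\ g k u).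
    rewrite (limn_sum_indic _ _ _ _ _ g_disj k1 gku) ger0_norm ?exprn_ge0//.
    (* The threshold is exactly the value of [y] on [g m]; being strict, it excludes [g m] itself
       and forces [m < k]. *)
    rewrite ltr_eXn2l ?ltr1n// ltn_exp2l// => mk.
    by exists (k - m.+1)%N => //; rewrite -addSnnS subnKC.
  rewrite limn_sum_indic0 => [|k k1 gku]; last by apply: (nog k).
  by rewrite normr0 ltNge exprn_ge0.
apply: le_trans (le_completed_lebesgue_measure _ _ _ tail) _.
apply: completed_lebesgue_measure_bigcup_le => [|n].
  by rewrite invr_ge0 exprn_ge0.
rewrite g_size ?addnS// lee_fin -invfM lef_pV2 ?posrE; last 2 first.
- by rewrite exprn_gt0.
- by rewrite mulr_gt0 ?exprn_gt0 ?ltr0n ?expn_gt0.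
(* With [j = m + n + 1], the factor [4 ^ (4 ^ j)] absorbs [4 ^ (4 ^ m.+1)], and the remaining factor
   [4 ^ j] absorbs the geometric weight [2 ^ n.+1]. *)
rewrite -!natrX -natrM ler_nat addnC expnD leq_mul//.
  by rewrite leq_exp2l// leq_exp2l// ltnS leq_addr.
by rewrite (@leq_trans (4 ^ n.+1)%N) ?leq_exp2r// leq_exp2l// ltnS leq_addl.
Qed.

Theorem lemma12 (R : realType) (h g : nat -> set R) (x y : R -> R)
    (h_meas : forall k : nat, (1 <= k)%N -> lebesgue_measurable (h k))
    (h_sub : forall k : nat, (1 <= k)%N -> h k `<=` [set u : R | 0 < u < 1])
    (h_disj : trivIset [set k : nat | (1 <= k)%N] h)
    (h_size : forall k : nat, (1 <= k)%N ->
      completed_lebesgue_measure (h k) = (2 ^- (k + 2 ^ k)%N)%:E)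
    (g_meas : forall k : nat, (1 <= k)%N -> lebesgue_measurable (g k))
    (g_sub : forall k : nat, (1 <= k)%N -> g k `<=` [set u : R | 0 < u < 1])
    (g_disj : trivIset [set k : nat | (1 <= k)%N] g)
    (g_size : forall k : nat, (1 <= k)%N ->
      completed_lebesgue_measure (g k) = (4 ^- (k + 4 ^ k)%N)%:E)
    (x_def : forall u : R, 0 < u < 1 ->
      x u = limn (fun n : nat => \sum_(1 <= k < n) 2 ^+ (2 ^ k)%N * \1_(h k) u : R))
    (y_def : forall u : R, 0 < u < 1 ->
      y u = limn (fun n : nat => \sum_(1 <= k < n) 4 ^+ (4 ^ k)%N * \1_(g k) u : R)) :
  ~ equivalent_distributions x y.
Proof.
move=> [C [C0 eqv]].
(* The level [m] only has to satisfy [C < 2 ^ m.+1]. *)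
pose m := Num.bound C.
have Cm : C < 2 ^+ m.+1 by apply: upper_nthrootP; rewrite leqW.
have [|+ _] := eqv (4 ^+ (4 ^ m)%N); first by rewrite exprn_gt0.
have := distribution_function_le _ _ _ g_disj g_size y_def m.
(* In base 2 the left exponent is [2 * 4 ^ m = 2 ^ (2m + 1)], just below [2 ^ (2m + 2)]. *)
have hk : 4 ^+ (4 ^ m)%N < 2 ^+ (2 ^ (2 * m.+1))%N :> R.
  rewrite -!natrX ltr_nat -[4%N]/(2 ^ 2)%N -!expnM ltn_exp2l//.
  by rewrite -expnS ltn_exp2l//; lia.
have := distribution_function_ge _ _ _ h_sub h_disj x_def (2 * m.+1)%N _ isT hk.
rewrite h_size// => nx ny xy.
have {nx ny xy} : (C^-1%:E * (2 ^- (2 * m.+1 + 2 ^ (2 * m.+1))%N)%:E <=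
    (4 ^- (4 ^ m.+1)%N)%:E)%E.
  apply: le_trans ny; apply: le_trans xy; apply: lee_wpmul2l nx.
  by rewrite lee_fin invr_ge0 ltW.
rewrite -EFinM lee_fin -invfM lef_pV2 ?posrE; last 2 first.
- by rewrite mulr_gt0// exprn_gt0.
- by rewrite exprn_gt0.
apply/negP; rewrite -ltNge.
(* Replacing [C] by [2 ^ m.+1] leaves only powers of 2: [3 * m.+1 + 4 ^ m.+1] against [2 * 4 ^ m.+1]
   in the exponent, which is what [lin] compares. *)
apply: (@lt_le_trans _ _ (2 ^+ m.+1 * 2 ^+ (2 * m.+1 + 2 ^ (2 * m.+1)))).
  by rewrite ltr_pM2r ?exprn_gt0.
have lin : (3 * m.+1 <= 4 ^ m.+1)%N.
  by elim: m.+1 => // n IHn; rewrite expnS; have := expn_gt0 4 n; lia.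
rewrite -exprD -!natrX ler_nat expnM -[(2 ^ 2)%N]/4%N.
by rewrite -[X in (_ <= X ^ _)%N]/(2 ^ 2)%N -expnM leq_exp2l//; lia.
Qed.
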